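(* Consider a game $G_{\Pi,C,F}$ that satisfies the following two assumptions. (Never alone) For every configuration $s\in S$, if there is a coin $c\in C$ with $|P_c(s)|\le 1$, then there is a miner $p\in\Pi$ such that changing $s.p$ to $c$ is a better response step for $p$ in $s$. (Generic game) For any two coins $c\ne c'$ in $C$ and any two sets of miners $P,P'\subseteq\Pi$, $\frac{F(c)}{\sum_{p\in P}m_p}\neq\frac{F(c')}{\sum_{p\in P'}m_p}$. Then for every stable configuration $s$ in $G_{\Pi,C,F}$ there exist a miner $p$ and a stable configuration $s'\neq s$ in which $u_p(s')>u_p(s)$.
   Context: The game $G_{\Pi,C,F}$: $\Pi$ is a finite set of $n$ miners, miner $p$ has mining power $m_p\in\mathbb{R}_+$; $C$ is a finite set of coins; $F:C\to\mathbb{R}_+$ assigns a reward to each coin ($\mathbb{R}_+$ denotes the positive reals). A configuration is an assignment of a coin to every miner; $S=C^n$ is the set of configurations and $s.p\in C$ is the coin chosen by $p$ in $s$. For $c\in C$, $P_c(s)=\{p\in\Pi: s.p=c\}$ and $M_c(s)=\sum_{p\in P_c(s)}m_p$. The payoff of miner $p$ is $u_p(s)=m_p\cdot F(s.p)/M_{s.p}(s)$. The configuration $(s_{-p},c)$ is identical to $s$ except that $p$ chooses $c$. Changing $s.p$ to $c$ is a better response step for $p$ in $s$ if $u_p(s)<u_p((s_{-p},c))$. A miner is stable in $s$ if it has no better response step in $s$; $s$ is stable (a pure equilibrium) if every miner is stable in $s$.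
   Formalization: The formal theorem assumes at least two coins (with a single coin and two or more miners both assumptions hold vacuously but there is only one configuration), and the generic-game condition ranges over nonempty sets of miners, where the quotients are defined. *)

(* Defs.v *)
From mathcomp Require Import all_boot all_order all_algebra.
From mathcomp Require Import reals.

Set Implicit Arguments.
Unset Strict Implicit.
Unset Printing Implicit Defensive.

Import Order.TTheory GRing.Theory Num.Theory.
Local Open Scope ring_scope.

Record coin_game (R : realType) (Pi C : finType) := CoinGame {
  power : Pi -> R;
  reward : C -> R;
  power_gt0 : forall p, 0 < power p;
  reward_gt0 : forall c, 0 < reward c
}.

Definition configuration (Pi C : finType) := {ffun Pi -> C}.

Section CoinGame.
Variables (R : realType) (Pi C : finType) (G : coin_game R Pi C).
Implicit Types (s : configuration Pi C) (p : Pi) (c : C).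

Definition miners_on s c : {set Pi} := [set p | s p == c].

Definition set_power (P : {set Pi}) : R := \sum_(p in P) power G p.

Definition coin_power s c : R := set_power (miners_on s c).

(* The denominator is positive, since p itself mines s p. *)
Definition payoff s p : R :=
  power G p * reward G (s p) / coin_power s (s p).

Definition deviate s p c : configuration Pi C :=
  [ffun q => if q == p then c else s q].

Definition better_response s p c : Prop :=
  payoff s p < payoff (deviate s p c) p.

Definition stable_miner s p : Prop := ~ exists c, better_response s p c.

Definition stable s : Prop := forall p, stable_miner s p.

Definition never_alone : Prop :=
  forall s c, (#|miners_on s c| <= 1)%N -> exists p, better_response s p c.

(* P and P' are nonempty because the quotients are otherwise undefined; with
   the convention x / 0 = 0, allowing both to be empty would make the condition
   false as soon as there are two coins. *)
Definition generic_game : Prop :=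
  forall c c', c != c' ->
  forall P P' : {set Pi}, P != set0 -> P' != set0 ->
    reward G c / set_power P <> reward G c' / set_power P'.

End CoinGame.

(* Main.v *)
Require Import Defs.
From mathcomp Require Import all_boot all_order all_algebra.
From mathcomp Require Import reals.

(** In a stable configuration no coin is empty, so the payoffs add up to the
    total reward. Two distinct stable configurations therefore have the same
    total payoff, while genericity forces the payoffs of any miner who changes
    coins to differ; hence each of them is strictly better for some miner.

    A second stable configuration is obtained by pinning the most powerful miner
    [p] to a coin [a] other than its current one, and letting the others join
    greedily in order of decreasing power. Every other miner is then stable. If
    [p] were alone on [a], some other miner would want to join it, by the
    never-alone assumption; so some [q] shares the coin with [p], and since [q]
    is stable and weaker than [p], [p] is stable too. *)

Import Order.TTheory GRing.Theory Num.Theory.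
Local Open Scope ring_scope.

Section TwoEquilibria.
Variables (R : realType) (Pi C : finType) (G : coin_game R Pi C).
Implicit Types (s : configuration Pi C) (p q : Pi) (c : C).

Local Notation m := (power G).
Local Notation F := (reward G).

(** [w] stands for power fixed on the coins in advance; only the miners of [B] are free to move. *)
Definition load (w : C -> R) (B : {set Pi}) s c : R :=
  w c + \sum_(q in B | s q == c) m q.

Lemma load_ge0 (w : C -> R) B s c : (forall c, 0 <= w c) -> 0 <= load w B s c.
Proof.
by move=> w_ge0; rewrite addr_ge0 ?sumr_ge0 // => q _; apply/ltW/power_gt0.
Qed.

Lemma load_gt0 (w : C -> R) (B : {set Pi}) s p :
  (forall c, 0 <= w c) -> p \in B -> 0 < load w B s (s p).
Proof.
move=> w_ge0 pB; rewrite /load (bigD1 p) /=; last by rewrite pB eqxx.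
rewrite ltr_wpDl // ltr_pwDl ?power_gt0 ?sumr_ge0 // => q _.
exact/ltW/power_gt0.
Qed.

Lemma load_deviate (w : C -> R) (B : {set Pi}) s p c d : p \in B ->
  load w B (deviate s p c) d =
    load w (B :\ p) s d + (if d == c then m p else 0).
Proof.
move=> pB; rewrite /load -addrA; congr (_ + _).
have eq_rest : \sum_(q in B | (deviate s p c q == d) && (q != p)) m q =
    \sum_(q in B :\ p | s q == d) m q.
  apply: eq_bigl => q; rewrite !inE ffunE.
  by case: (eqVneq q p) => [->|_]; rewrite ?andbF ?andbT.
case: (eqVneq d c) => [dc|neq_dc].
  rewrite (bigD1 p) /=; last by rewrite pB ffunE eqxx dc eqxx.
  rewrite addrC -eq_rest; congr (_ + _).
  by apply: eq_bigl => q; rewrite andbA.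
rewrite addr0 -eq_rest; apply: eq_bigl => q; rewrite ffunE.
by case: (eqVneq q p); rewrite ?andbT //= eq_sym (negPf neq_dc) !andbF.
Qed.

Lemma ler_share c (x y : R) : 0 < x -> x <= y -> F c / y <= F c / x.
Proof.
move=> x_gt0 le_xy; rewrite ler_pM2l ?reward_gt0 // lef_pV2 ?posrE //.
exact: lt_le_trans le_xy.
Qed.

(* Adding a weakest miner on its best coin preserves stability: the miners
   already there are at least as powerful, so they gain even less by leaving. *)
Lemma greedy_equilibrium (w : C -> R) (c0 : C) (B : {set Pi}) :
  (forall c, 0 <= w c) ->
  exists s, forall p, p \in B -> forall c, c != s p ->
    F c / (load w B s c + m p) <= F (s p) / load w B s (s p).
Proof.
move=> w_ge0; have [n] := ubnP #|B|; elim: n B => // n IHn B leBn.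
have [->|/set0Pn[p0 p0B]] := eqVneq B set0.
  by exists [ffun=> c0] => p; rewrite inE.
have [p pB min_p] :=
  @arg_minP _ _ _ p0 (fun q => q \in B) m p0B.
have [|s sP] := IHn (B :\ p).
  by move: leBn; rewrite (cardsD1 p B) pB.
have [b _ max_b] :=
  @arg_maxP _ _ _ c0 xpredT (fun c => F c / (load w (B :\ p) s c + m p)) isT.
exists (deviate s p b) => q qB c.
have Lge0 d : 0 <= load w (B :\ p) s d by exact: load_ge0.
have le_pq := min_p q qB.
rewrite !load_deviate //.
(* Here [q] is [p] or at least as powerful: on [b] it gets the reward per unit of power that is
   maximal for [p], and it would dilute [c] at least as much as [p]. *)
have [sqb|sqb] := eqVneq (deviate s p b q) b.
  rewrite sqb => neq_cb; rewrite (negPf neq_cb) addr0.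
  apply: le_trans (max_b c isT); apply: ler_share; last by rewrite lerD2l.
  by rewrite ltr_wpDl ?power_gt0.
have neq_qp : q != p by apply: contraNneq sqb => ->; rewrite ffunE eqxx.
move: sqb; rewrite ffunE (negPf neq_qp) => sqb neq_c.
(* Off [b], the load of [q]'s coin is unchanged and no other coin got lighter, so the inductive
   bound still applies. *)
rewrite addr0.
apply: le_trans (sP q _ c neq_c); last by rewrite !inE neq_qp.
apply: ler_share; first by rewrite ltr_wpDl ?power_gt0.
by rewrite lerD2r lerDl; case: ifP => // _; apply/ltW/power_gt0.
Qed.

Lemma coin_power_load s c : coin_power G s c = load (fun=> 0) setT s c.
Proof. by rewrite /load add0r; apply: eq_bigl => q; rewrite !inE. Qed.

Lemma coin_power_gt0 s p : 0 < coin_power G s (s p).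
Proof. by rewrite coin_power_load load_gt0. Qed.

Lemma coin_power_join s p c : c != s p ->
  coin_power G (deviate s p c) c = coin_power G s c + m p.
Proof.
move=> neq_c; rewrite !coin_power_load load_deviate // eqxx; congr (_ + _).
rewrite /load; congr (_ + _); apply: eq_bigl => q; rewrite !inE andbT.
by case: (eqVneq q p) => // ->; rewrite eq_sym (negPf neq_c).
Qed.

(** The miner's own power cancels: only rewards per unit of power matter, which makes miners of
    different power comparable. *)
Lemma better_responseE s p c : c != s p ->
  better_response G s p c <->
  F (s p) / coin_power G s (s p) < F c / (coin_power G s c + m p).
Proof.
move=> neq_c; rewrite /better_response /payoff ffunE eqxx coin_power_join //.
by rewrite -!mulrA ltr_pM2l ?power_gt0.
Qed.

Lemma better_response_neq s p c : better_response G s p c -> c != s p.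
Proof.
apply: contraPneq => -> /=; rewrite /better_response.
suff -> : deviate s p (s p) = s by rewrite ltxx.
by apply/ffunP => q; rewrite ffunE; case: eqP => [->|].
Qed.

Lemma stable_minerP s p :
  stable_miner G s p <->
  forall c, c != s p ->
    F c / (coin_power G s c + m p) <= F (s p) / coin_power G s (s p).
Proof.
split=> [st c neq_c | st [c br]].
  by rewrite leNgt; apply/negP => lt_c; apply: st; exists c; apply/better_responseE.
have neq_c := better_response_neq _ _ _ br.
by move/(better_responseE _ _ _ neq_c): br; rewrite ltNge st.
Qed.

Lemma stable_pinned p a : never_alone G -> (forall q, m q <= m p) ->
  exists2 s, stable G s & s p = a.
Proof.
move=> hnever max_p.
(* The pinned miner becomes a fixed weight on [a], so the greedy lemma handles all the others. *)
pose w c := if c == a then m p else 0.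
have w_ge0 c : 0 <= w c by rewrite /w; case: ifP => // _; apply/ltW/power_gt0.
have [s0 s0P] := greedy_equilibrium w a [set~ p] w_ge0.
pose s := deviate s0 p a.
have sp : s p = a by rewrite ffunE eqxx.
have powE c : coin_power G s c = load w [set~ p] s0 c.
  by rewrite coin_power_load load_deviate // /load add0r addrC setTD.
have st_other q : q != p -> stable_miner G s q.
  move=> neq_q; apply/stable_minerP => c; rewrite !powE ffunE (negPf neq_q).
  by apply: s0P; rewrite !inE.
exists s => // q; have [->{q}|] := eqVneq q p; last exact: st_other.
have [alone|] := leqP #|miners_on s a| 1.
  have [q br] := hnever s a alone.
  have neq_qp : q != p.
    by apply: contraTneq (better_response_neq _ _ _ br) => ->; rewrite sp eqxx.
  by case: (st_other q neq_qp); exists a.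
rewrite (cardsD1 p) inE sp eqxx ltnS card_gt0 => /set0Pn[q].
rewrite !inE => /andP[neq_qp /eqP sq].
have /stable_minerP st_q := st_other q neq_qp.
(* On [a], [p] and [q] get the same reward per unit of power, while [p] would dilute [c] at least as
   much as [q]. *)
apply/stable_minerP => c; rewrite sp -sq => neq_c.
apply: le_trans (st_q c neq_c); apply: ler_share; last by rewrite lerD2l.
by rewrite ltr_wpDl ?power_gt0 // powE load_ge0.
Qed.

Lemma sum_payoff s : never_alone G -> stable G s ->
  \sum_p payoff G s p = \sum_c F c.
Proof.
move=> hnever st; rewrite (partition_big s xpredT) //=; apply: eq_bigr => c _.
have [empty|/set0Pn[p]] := eqVneq (miners_on s c) set0.
  have [|p br] := hnever s c; first by rewrite empty cards0.
  by case: (st p); exists c.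
rewrite inE => /eqP sp.
under eq_bigr => q /eqP sq do rewrite /payoff sq -mulrA.
rewrite -mulr_suml.
have -> : \sum_(q | s q == c) m q = coin_power G s c.
  by apply: eq_bigl => q; rewrite inE.
by rewrite mulrC divfK // -sp gt_eqF ?coin_power_gt0.
Qed.

(** After cancelling [m p], genericity applies to the two sets of miners sharing [p]'s coin; both
    contain [p], so neither is empty. *)
Lemma payoff_inj s s' p : generic_game G ->
  payoff G s p = payoff G s' p -> s p = s' p.
Proof.
move=> hgen; rewrite /payoff -!mulrA => /(mulfI (lt0r_neq0 (power_gt0 G p))) eq_share.
apply/eqP/negPn/negP => /hgen /(_ (miners_on s (s p)) (miners_on s' (s' p))).
by case=> //; apply/set0Pn; exists p; rewrite inE.
Qed.

Lemma exists_better s s' : never_alone G -> generic_game G ->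
  stable G s -> stable G s' -> s' <> s -> exists p, payoff G s p < payoff G s' p.
Proof.
move=> hnever hgen st st' neq_s.
have [/existsP //|/existsPn le_pay] := boolP [exists p, payoff G s p < payoff G s' p].
case: neq_s; apply/ffunP => p; apply: (payoff_inj _ _ _ hgen); apply/eqP.
have le_s q : true -> payoff G s' q <= payoff G s q.
  by move=> _; rewrite leNgt le_pay.
(* If nobody gains, termwise inequality between equal sums forces equality for every miner. *)
have := leif_sum (fun q (_ : true) => leif_eq (le_s q isT)).
by rewrite !sum_payoff // => -[_]; rewrite eqxx => /esym/forallP/(_ p).
Qed.

End TwoEquilibria.

Theorem proposition2 (R : realType) (Pi C : finType) (G : coin_game R Pi C)
    (hC : (1 < #|C|)%N)
    (hnever : never_alone G) (hgeneric : generic_game G)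
    (s : configuration Pi C) (hs : stable G s) :
  exists (p : Pi) (s' : configuration Pi C),
    [/\ stable G s', s' <> s & payoff G s p < payoff G s' p].
Proof.
have /card_gt0P[c0 _] : (0 < #|C|)%N by exact: ltnW.
(* Either [c0] already has miners, or [hnever] supplies one. *)
have [p0 _] : exists p : Pi, true.
  have [le1|/ltnW/card_gt0P[p _]] := leqP #|miners_on s c0| 1; last by exists p.
  by have [p _] := hnever s c0 le1; exists p.
have [p _ max_p] := @arg_maxP _ _ _ p0 xpredT (power G) isT.
have [a neq_a] : exists a, a != s p.
  by apply/existsP; rewrite -negb_forall; apply: contraL hC => /forallP eq_s;
     rewrite -leqNgt; apply/card_le1_eqP => x y _ _; rewrite (eqP (eq_s x)) (eqP (eq_s y)).
have [s' st' s'p] := stable_pinned R Pi C G p a hnever (fun q => max_p q isT).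
have neq_s : s' <> s by move=> eq_s; rewrite -s'p eq_s eqxx in neq_a.
have [q lt_q] := exists_better R Pi C G s s' hnever hgeneric hs st' neq_s.
by exists q, s'.
Qed.
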